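(* Let $(x_k,z_k)_{k\ge 0}$ be the iterates of FISTA or of APG (as defined in the context) applied to the minimization of $F=f+\psi$ on $\mathbb{R}^n$. Let $\sigma\in[0,1]$ and, for $k\ge 1$, let $\bar x_k=(1-\sigma)x_k+\sigma z_k$. Then $$\frac12\|\bar x_k-x_*\|_v^2\le \frac12\max\left(\sigma,\,1-\frac{\sigma\mu_F(v)}{\theta_{k-1}^2}\right)\|x_0-x_*\|_v^2 .$$
   Context: Problem: $f:\mathbb{R}^n\to\mathbb{R}$ is convex and differentiable; $\psi(x)=\sum_{i=1}^n\psi^i(x^i)$ where each $\psi^i:\mathbb{R}\to\mathbb{R}\cup\{+\infty\}$ is closed and convex; $F=f+\psi$; $x_*$ is a minimizer of $F$; $\operatorname{dom}\psi=\{x:\psi(x)<+\infty\}$. For a vector $v$ with positive entries, $\|x\|_v^2=\sum_{i=1}^n v_i(x^i)^2$. Assumption on $v$: $f(x+h)\le f(x)+\langle\nabla f(x),h\rangle+\frac12\|h\|_v^2$ for all $x,h\in\mathbb{R}^n$. Strong convexity assumption: $\mu_F(v)>0$ is a constant such that $F(x)\ge F(x_* )+\frac{\mu_F(v)}{2}\|x-x_*\|_v^2$ for all $x\in\mathbb{R}^n$. Both algorithms: choose $x_0\in\operatorname{dom}\psi$, $z_0=x_0$, $\theta_0=1$, $\theta_{k+1}=\frac{\sqrt{\theta_k^4+4\theta_k^2}-\theta_k^2}{2}$, and $y_k=(1-\theta_k)x_k+\theta_kz_k$ for $k\ge0$. FISTA: $x_{k+1}=\arg\min_{x\in\mathbb{R}^n}\{\langle\nabla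 f(y_k),x-y_k\rangle+\frac12\|x-y_k\|_v^2+\psi(x)\}$ and $z_{k+1}=z_k+\frac1{\theta_k}(x_{k+1}-y_k)$. APG: $z_{k+1}=\arg\min_{z\in\mathbb{R}^n}\{\langle\nabla f(y_k),z-y_k\rangle+\frac{\theta_k}{2}\|z-z_k\|_v^2+\psi(z)\}$ and $x_{k+1}=y_k+\theta_k(z_{k+1}-z_k)$. *)

(* Defs.v *)
From HB Require Import structures.
From mathcomp Require Import all_boot all_order all_algebra.
From mathcomp Require Import all_classical all_reals all_analysis.

Set Implicit Arguments.
Unset Strict Implicit.
Unset Printing Implicit Defensive.

Import Order.TTheory GRing.Theory Num.Theory.
Import numFieldNormedType.Exports.

Local Open Scope classical_set_scope.
Local Open Scope ring_scope.

Section ExtendedValuedFunctions.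
Context {R : realType}.

(* For [a] in {0, 1} the product [0 * +oo] is [0], so the endpoint cases of the
   inequality are trivial, as they should be. *)
Definition econvex (g : R -> \bar R) :=
  forall (s t a : R), 0 <= a <= 1 ->
    (g (a * s + (1 - a) * t)%R <= a%:E * g s + (1 - a)%:E * g t)%E.

Definition epigraph (g : R -> \bar R) : set (R * R) :=
  [set p | (g p.1 <= p.2%:E)%E].

Definition closed_fun (g : R -> \bar R) := closed (epigraph g).

Definition edom (T : Type) (g : T -> \bar R) : set T :=
  [set x | (g x < +oo)%E].

(* The models minimized by the algorithms are strongly convex and have a finite
   value, so for them this set is a singleton. *)
Definition argmin (T : Type) (g : T -> \bar R) : set T :=
  [set x | forall y, (g x <= g y)%E].

End ExtendedValuedFunctions.

Section EuclideanSpace.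
Context {R : realType} {n : nat}.
Implicit Types (f : 'rV[R]_n -> R) (v x y : 'rV[R]_n).

Definition dotv x y : R := \sum_(i < n) x 0 i * y 0 i.

Definition sqnormv v x : R := \sum_(i < n) v 0 i * x 0 i ^+ 2.

Definition grad f x : 'rV[R]_n := \row_(i < n) 'D_(delta_mx 0 i) f x.

Definition separable_sum (psi : 'I_n -> R -> \bar R) x : \bar R :=
  (\sum_(i < n) psi i (x 0%R i))%E.

Definition composite f (psi : 'I_n -> R -> \bar R) x : \bar R :=
  ((f x)%:E + separable_sum psi x)%E.

End EuclideanSpace.

Section AcceleratedMethods.
Context {R : realType} {n : nat}.
Variables (f : 'rV[R]_n -> R) (psi : 'I_n -> R -> \bar R) (v : 'rV[R]_n).

Fixpoint theta (k : nat) : R :=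
  if k is j.+1 then
    (Num.sqrt (theta j ^+ 4 + 4 * theta j ^+ 2) - theta j ^+ 2) / 2
  else 1.

Definition mid_iterate (x z : nat -> 'rV[R]_n) (k : nat) : 'rV[R]_n :=
  (1 - theta k) *: x k + theta k *: z k.

Definition fista_model (y w : 'rV[R]_n) : \bar R :=
  ((dotv (grad f y) (w - y) + 2^-1 * sqnormv v (w - y))%:E
   + separable_sum psi w)%E.

Definition apg_model (t : R) (y z w : 'rV[R]_n) : \bar R :=
  ((dotv (grad f y) (w - y) + t / 2 * sqnormv v (w - z))%:E
   + separable_sum psi w)%E.

Definition fista_iterates (x z : nat -> 'rV[R]_n) : Prop :=
  [/\ edom (separable_sum psi) (x 0%N),
      z 0%N = x 0%N &
      forall k, let y := mid_iterate x z k in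
        argmin (fista_model y) (x k.+1) /\
        z k.+1 = z k + (theta k)^-1 *: (x k.+1 - y)].

Definition apg_iterates (x z : nat -> 'rV[R]_n) : Prop :=
  [/\ edom (separable_sum psi) (x 0%N),
      z 0%N = x 0%N &
      forall k, let y := mid_iterate x z k in
        argmin (apg_model (theta k) y (z k)) (z k.+1) /\
        x k.+1 = y + theta k *: (z k.+1 - z k)].

End AcceleratedMethods.

(* Main.v *)
(* Both methods satisfy x_{k+1} = (1 - theta_k) x_k + theta_k z_{k+1}.  The
   three-point inequality for the minimized model (compared at
   (1 - theta_k) x_k + theta_k x_* for FISTA, at x_* for APG) yields the same
   one-step decrease in both cases; since
   (1 - theta_{k+1}) / theta_{k+1}^2 = 1 / theta_k^2, it telescopes to
     2 (F x_k - F x_* ) / theta_{k-1}^2 + |z_k - x_*|^2 <= |x_0 - x_*|^2.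
   So |z_k - x_*| <= |x_0 - x_*|, and |x_k - x_*| <= |x_0 - x_*| because x_k is
   an average of the z_j.  With A = |x_k - x_*|^2, B = |z_k - x_*|^2,
   D = |x_0 - x_*|^2 and c = mu / theta_{k-1}^2, growth gives c A + B <= D, hence
     (1 - sigma) A + sigma B <= (1 - sigma - sigma c) A + sigma D,
   and one concludes with A >= 0 or A <= D according to the sign of
   1 - sigma - sigma c. *)
Require Import Defs.
From mathcomp Require Import all_boot all_order all_algebra.
From mathcomp Require Import all_classical all_reals all_analysis.
From mathcomp Require Import ring lra.
Set Implicit Arguments.
Unset Strict Implicit.
Unset Printing Implicit Defensive.

Import Order.TTheory GRing.Theory Num.Theory.
Import numFieldNormedType.Exports.
Local Open Scope classical_set_scope.
Local Open Scope ring_scope.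

(** This replaces a limit as [a] tends to 0 from above in the variational argument below. *)
Lemma ge0_affine_at_0 (R : realFieldType) (p q : R) :
  (forall a, 0 < a <= 1 -> 0 <= p + a * q) -> 0 <= p.
Proof.
move=> pq; rewrite leNgt; apply/negP => p0.
have d0 : 0 < `|q| + 1 - p by have := normr_ge0 q; lra.
(* For [p < 0] this witness lies in (0, 1] and is so small that [a * q < - p]. *)
have := pq (- p / (`|q| + 1 - p)).
rewrite divr_gt0 ?oppr_gt0// ler_pdivrMr// mul1r lerDr addr_ge0//.
have -> : p + - p / (`|q| + 1 - p) * q =
    p * (`|q| + 1 - p - q) / (`|q| + 1 - p) by field; exact: lt0r_neq0.
move=> /(_ isT); rewrite pmulr_lge0 ?invr_gt0// nmulr_rge0//.
have := ler_norm q; lra.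
Qed.

(** * Weighted norm identities and the gradient inequality *)

Section WeightedNorm.
Context {R : realType} {n : nat}.
Implicit Types (f : 'rV[R]_n -> R) (v x y z g : 'rV[R]_n) (a : R).

Lemma dotvD g x y : dotv g (x + y) = dotv g x + dotv g y.
Proof.
by rewrite /dotv -big_split; apply: eq_bigr => i _; rewrite mxE mulrDr.
Qed.

Lemma dotvZ g a x : dotv g (a *: x) = a * dotv g x.
Proof.
by rewrite /dotv mulr_sumr; apply: eq_bigr => i _; rewrite mxE mulrCA.
Qed.

Lemma sqnormv_ge0 v x : (forall i, 0 < v 0 i) -> 0 <= sqnormv v x.
Proof.
by move=> v0; apply: sumr_ge0 => i _; rewrite mulr_ge0 ?sqr_ge0// ltW.
Qed.

Lemma sqnormvZ v a x : sqnormv v (a *: x) = a ^+ 2 * sqnormv v x.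
Proof.
by rewrite /sqnormv mulr_sumr; apply: eq_bigr => i _; rewrite mxE; ring.
Qed.

Lemma sqnormv_distC v x y : sqnormv v (x - y) = sqnormv v (y - x).
Proof. by apply: eq_bigr => i _; rewrite !mxE; ring. Qed.

(** The exact defect of convexity; its last term is the source of strong convexity of the models. *)
Lemma sqnormv_conv v a x y z :
  sqnormv v ((1 - a) *: x + a *: y - z) =
  (1 - a) * sqnormv v (x - z) + a * sqnormv v (y - z)
  - a * (1 - a) * sqnormv v (y - x).
Proof.
rewrite /sqnormv !mulr_sumr -big_split/= -sumrB; apply: eq_bigr => i _.
by rewrite !mxE; ring.
Qed.

Lemma dotv_grad f x h : differentiable f x -> 'D_h f x = dotv (grad f x) h.
Proof.
move=> df; rewrite deriveE// {1}[h]row_sum_delta linear_sum.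
by apply: (@eq_bigr R) => i _; rewrite linearZ mxE deriveE// mulrC.
Qed.

Lemma convex_function_le f a x y : convex_function (E := 'rV[R]_n) setT f ->
  0 <= a <= 1 -> f ((1 - a) *: x + a *: y) <= (1 - a) * f x + a * f y.
Proof.
move=> fc /andP[a0 a1].
have := fc (Itv01 a0 a1) y x (mem_set I) (mem_set I).
by rewrite convRE/= [leRHS]addrC [X in f X <= _]addrC.
Qed.

(** By convexity the difference quotients along the segment from [x] to [y] are at most [f y - f x]
    for steps in (0, 1], so a right-sided limit suffices. *)
Lemma convex_grad_le f x y : convex_function (E := 'rV[R]_n) setT f ->
  differentiable f x -> f x + dotv (grad f x) (y - x) <= f y.
Proof.
move=> fc df; rewrite -dotv_grad// addrC -lerBrDr.
have /cvg_dnbhs_at_right dr := @diff_derivable _ _ _ f x (y - x) df.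
rewrite /derive -(cvg_lim _ dr)//; apply: limr_le; first exact: (cvgP _ dr).
near=> a.
have a0 : 0 < a by near: a; exact: nbhs_right_gt.
have a1 : a <= 1 by near: a; apply: nbhs_right_le.
rewrite /= ler_pdivrMl//.
have := @convex_function_le f a x y fc; rewrite (ltW a0) a1 => /(_ isT).
have -> : (1 - a) *: x + a *: y = a *: (y - x) + x.
  by apply/rowP => i; rewrite !mxE; ring.
lra.
Unshelve. all: by end_near. Qed.

End WeightedNorm.

(** * The separable term and minimizers of the quadratic models *)

Section SeparableSum.
Context {R : realType} {n : nat} (psi : 'I_n -> R -> \bar R).
Hypothesis psi_noninfty : forall i t, psi i t <> -oo%E.
Implicit Types (x y z g : 'rV[R]_n) (a : R).

Lemma separable_sum_fin_num x :
  (separable_sum psi x < +oo)%E -> separable_sum psi x \is a fin_num.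
Proof.
rewrite fin_numE => /lt_eqF ->; rewrite andbT.
by apply/eqP => /esum_eqNyP[i [_ _]]; exact: psi_noninfty.
Qed.

Lemma separable_sum_conv x y a : (forall i, econvex (psi i)) -> 0 <= a <= 1 ->
  separable_sum psi x \is a fin_num -> separable_sum psi y \is a fin_num ->
  separable_sum psi ((1 - a) *: x + a *: y) \is a fin_num /\
  fine (separable_sum psi ((1 - a) *: x + a *: y)) <=
    (1 - a) * fine (separable_sum psi x) + a * fine (separable_sum psi y).
Proof.
move=> psi_convex a01 xfin yfin.
have /sum_fin_numP xi := xfin; have /sum_fin_numP yi := yfin.
have le_conv : (separable_sum psi ((1 - a) *: x + a *: y) <=
    ((1 - a) * fine (separable_sum psi x)
     + a * fine (separable_sum psi y))%:E)%E.
  rewrite /separable_sum -!sum_fine; last 2 first.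
    by move=> i _; apply: yi; rewrite ?mem_index_enum.
    by move=> i _; apply: xi; rewrite ?mem_index_enum.
  rewrite !mulr_sumr -big_split/= -sumEFin; apply: lee_sum => i _.
  rewrite !mxE EFinD !EFinM !fineK ?xi ?yi ?mem_index_enum//.
  by rewrite addrC addeC; exact: psi_convex.
have cfin : separable_sum psi ((1 - a) *: x + a *: y) \is a fin_num.
  by apply: separable_sum_fin_num; apply: le_lt_trans le_conv (ltry _).
by split=> //; rewrite -lee_fin fineK.
Qed.

Variable (v : 'rV[R]_n).

(** The model is strongly convex with modulus [t]. The center [c] is kept apart from [y] so as to
    cover both FISTA ([c = y], [t = 1]) and APG ([c] the current [z]). *)
Lemma argmin_three_point g y c t z w : (forall i, econvex (psi i)) ->
  argmin (fun u => ((dotv g (u - y) + t / 2 * sqnormv v (u - c))%:E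
                    + separable_sum psi u)%E) z ->
  separable_sum psi w \is a fin_num ->
  separable_sum psi z \is a fin_num /\
  dotv g (z - y) + t / 2 * sqnormv v (z - c) + fine (separable_sum psi z)
    + t / 2 * sqnormv v (w - z) <=
  dotv g (w - y) + t / 2 * sqnormv v (w - c) + fine (separable_sum psi w).
Proof.
move=> psi_convex zmin wfin.
have zfin : separable_sum psi z \is a fin_num.
  apply: separable_sum_fin_num; have := zmin w.
  rewrite -(fineK wfin) -EFinD.
  case E : (separable_sum psi z) => [r| |] //; by rewrite ?ltry.
split=> //.
set Q := t / 2 * sqnormv v (w - z); set d := (X in _ <= X).
set m := _ + fine (separable_sum psi z).
(* Minimality of [z] against [(1 - a) *: z + a *: w], divided by [a]; the error [a * Q] vanishes as
   [a] tends to 0. *)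
have along a : 0 < a <= 1 -> 0 <= d - m - Q + a * Q.
  move=> /andP[a0 a1].
  have a01 : 0 <= a <= 1 by rewrite (ltW a0).
  have [cfin cle] := @separable_sum_conv z w a psi_convex a01 zfin wfin.
  have := zmin ((1 - a) *: z + a *: w).
  rewrite -(fineK cfin) -(fineK zfin) -!EFinD lee_fin sqnormv_conv => mle.
  have dotE : dotv g ((1 - a) *: z + a *: w - y) =
      (1 - a) * dotv g (z - y) + a * dotv g (w - y).
    rewrite -!dotvZ -dotvD; congr dotv.
    by apply/rowP => i; rewrite !mxE; ring.
  rewrite dotE in mle.
  rewrite -(pmulr_rge0 _ a0) /d /m /Q.
  lra.
rewrite -subr_ge0.
have -> : d - (m + Q) = d - m - Q by ring.
exact: ge0_affine_at_0 along.
Qed.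

End SeparableSum.

(** * The parameter sequence *)

Section Theta.
Context {R : realType}.

(** With [t = theta k], the radicand lies between the squares of [t ^+ 2] and [t ^+ 2 + 2]. *)
Lemma theta_bounds k : 0 < (theta k : R) <= 1.
Proof.
elim: k => [|k /andP[t0 t1]]; first by rewrite /= ltr01 lexx.
rewrite /=; set t := theta k in t0 t1 *.
have s0 : 0 <= t ^+ 4 + 4 * t ^+ 2.
  by rewrite addr_ge0 ?mulr_ge0 ?exprn_ge0// ltW.
have t2 : 0 < t ^+ 2 by rewrite exprn_gt0.
have t4 : 0 < t ^+ 4 by rewrite exprn_gt0.
apply/andP; split.
  rewrite divr_gt0// subr_gt0 -[ltLHS]ger0_norm ?(ltW t2)// -sqrtr_sqr.
  rewrite ltr_sqrt; lra.
rewrite ler_pdivrMr// mul1r lerBlDr -[leRHS]ger0_norm ?addr_ge0 ?(ltW t2)//.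
rewrite -sqrtr_sqr ler_wsqrtr//; lra.
Qed.

(** [theta k.+1] is the positive root of [s ^+ 2 + t ^+ 2 * s - t ^+ 2] with [t = theta k]; this is
    what makes the decrease telescope. *)
Lemma theta_recE k : (theta k.+1) ^+ 2 = (1 - theta k.+1) * (theta k) ^+ 2 :> R.
Proof.
have /andP[t0 _] := theta_bounds k.
rewrite /=; set t := theta k in t0 *.
have s0 : 0 <= t ^+ 4 + 4 * t ^+ 2.
  by rewrite addr_ge0 ?mulr_ge0 ?exprn_ge0// ltW.
have := sqr_sqrtr s0; set s := Num.sqrt _ => sE.
have : (s - t ^+ 2) ^+ 2 = t ^+ 4 + 4 * t ^+ 2 - 2 * s * t ^+ 2 + t ^+ 4.
  by rewrite -sE; ring.
move=> E; by rewrite expr_div_n E; field.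
Qed.

End Theta.

(** * One-step decrease and the Lyapunov bound *)

Section AcceleratedStep.
Context {R : realType} {n : nat}.
Variables (f : 'rV[R]_n -> R) (psi : 'I_n -> R -> \bar R) (v : 'rV[R]_n).
Hypothesis f_convex : convex_function (E := 'rV[R]_n) setT f.
Hypothesis f_diff : forall x, differentiable f x.
Hypothesis psi_noninfty : forall i t, psi i t <> -oo%E.
Hypothesis psi_convex : forall i, econvex (psi i).
Hypothesis f_smooth : forall x h,
  f (x + h) <= f x + dotv (grad f x) h + 2^-1 * sqnormv v h.

(** [fine] sends infinite values to 0, so [F] is the true objective only where the separable sum is
    finite; finiteness is therefore carried along. *)
Let F x := f x + fine (separable_sum psi x).

Definition accelerated_step (u : 'rV[R]_n) t x z x' z' :=
  [/\ x' = (1 - t) *: x + t *: z',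
      separable_sum psi x' \is a fin_num &
      F x' <= (1 - t) * F x + t * F u
              + t ^+ 2 / 2 * (sqnormv v (z - u) - sqnormv v (z' - u))].

(** With [w = (1 - t) *: x + t *: u], the differences [w - y] and [w - x'] are [t] times [u - z] and
    [u - z'], hence the factor [t ^+ 2 / 2]. *)
Lemma fista_step u t x z x' z' : 0 < t <= 1 ->
  separable_sum psi u \is a fin_num -> separable_sum psi x \is a fin_num ->
  let y := (1 - t) *: x + t *: z in
  argmin (fista_model f psi v y) x' -> z' = z + t^-1 *: (x' - y) ->
  accelerated_step u t x z x' z'.
Proof.
move=> /andP[t0 t1] ufin xfin y x'min z'E.
have x'E : x' = (1 - t) *: x + t *: z'.
  rewrite z'E; apply/rowP => i; rewrite !mxE; field; exact: lt0r_neq0.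
set w := (1 - t) *: x + t *: u.
have t01 : 0 <= t <= 1 by rewrite (ltW t0).
have [wfin wle] := separable_sum_conv psi_noninfty psi_convex t01 xfin ufin.
have := @argmin_three_point _ _ _ psi_noninfty v (grad f y) y y 1 x' w
  psi_convex.
rewrite div1r => /(_ x'min wfin)[x'fin three].
split=> //.
have fx' := f_smooth y (x' - y); rewrite subrKC in fx'.
have wyE : w - y = t *: (u - z).
  by apply/rowP => i; rewrite !mxE; ring.
have wxE : w - x' = t *: (u - z').
  by rewrite x'E; apply/rowP => i; rewrite !mxE; ring.
have wyE' : w - y = (1 - t) *: (x - y) + t *: (u - y).
  by apply/rowP => i; rewrite !mxE; ring.
have dotE : dotv (grad f y) (w - y) =
    (1 - t) * dotv (grad f y) (x - y) + t * dotv (grad f y) (u - y).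
  by rewrite -!dotvZ -dotvD wyE'.
rewrite dotE wxE wyE !sqnormvZ in three.
have gx := convex_grad_le x f_convex (f_diff y).
have gu := convex_grad_le u f_convex (f_diff y).
have gx' : (1 - t) * (f y + dotv (grad f y) (x - y)) <= (1 - t) * f x.
  by rewrite ler_wpM2l// subr_ge0.
have gu' : t * (f y + dotv (grad f y) (u - y)) <= t * f u.
  by rewrite ler_wpM2l// ltW.
rewrite /F ![sqnormv v (_ - u)]sqnormv_distC.
lra.
Qed.

(** Scaled by [t], the three-point inequality contains [t ^+ 2 / 2] times the squared norm of
    [z' - z], which cancels the smoothness term since [x' - y = t *: (z' - z)]. Convexity of the
    separable sum passes from [z'] to [x']. *)
Lemma apg_step u t x z x' z' : 0 < t <= 1 ->
  separable_sum psi u \is a fin_num -> separable_sum psi x \is a fin_num ->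
  let y := (1 - t) *: x + t *: z in
  argmin (apg_model f psi v t y z) z' -> x' = y + t *: (z' - z) ->
  accelerated_step u t x z x' z'.
Proof.
move=> /andP[t0 t1] ufin xfin y z'min x'E0.
have x'E : x' = (1 - t) *: x + t *: z'.
  by rewrite x'E0; apply/rowP => i; rewrite !mxE; ring.
have t01 : 0 <= t <= 1 by rewrite (ltW t0).
have [z'fin three] := argmin_three_point psi_noninfty psi_convex z'min ufin.
have [x'fin x'le] :=
  separable_sum_conv psi_noninfty psi_convex t01 xfin z'fin.
rewrite -x'E in x'fin x'le.
split=> //.
have fx' := f_smooth y (x' - y); rewrite subrKC in fx'.
have xyE : x' - y = t *: (z' - z) by rewrite x'E0 addrAC subrr add0r.
have xyE' : x' - y = (1 - t) *: (x - y) + t *: (z' - y).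
  by rewrite x'E; apply/rowP => i; rewrite !mxE; ring.
have dotE : dotv (grad f y) (x' - y) =
    (1 - t) * dotv (grad f y) (x - y) + t * dotv (grad f y) (z' - y).
  by rewrite -!dotvZ -dotvD xyE'.
rewrite dotE xyE sqnormvZ in fx'.
have gx := convex_grad_le x f_convex (f_diff y).
have gu := convex_grad_le u f_convex (f_diff y).
have gx' : (1 - t) * (f y + dotv (grad f y) (x - y)) <= (1 - t) * f x.
  by rewrite ler_wpM2l// subr_ge0.
have gu' : t * (f y + dotv (grad f y) (u - y)) <= t * f u.
  by rewrite ler_wpM2l// ltW.
have three' := ler_wpM2l (ltW t0) three.
rewrite /F ![sqnormv v (_ - u)]sqnormv_distC.
lra.
Qed.

Lemma iterates_accelerated_step u x z : separable_sum psi u \is a fin_num ->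
  fista_iterates f psi v x z \/ apg_iterates f psi v x z ->
  forall k, accelerated_step u (theta k) (x k) (z k) (x k.+1) (z k.+1).
Proof.
move=> ufin xz.
have [x0fin step] : separable_sum psi (x 0%N) \is a fin_num /\
    forall k, separable_sum psi (x k) \is a fin_num ->
      accelerated_step u (theta k) (x k) (z k) (x k.+1) (z k.+1).
  case: xz => -[/(separable_sum_fin_num psi_noninfty) x0fin _ step].
    split=> // k xfin; have [xmin zE] := step k.
    exact: fista_step (theta_bounds k) ufin xfin xmin zE.
  split=> // k xfin; have [zmin xE] := step k.
  exact: apg_step (theta_bounds k) ufin xfin zmin xE.
(* Each step assumes finiteness at [x k] and returns it at [x k.+1]. *)
have xfin k : separable_sum psi (x k) \is a fin_num.
  by elim: k => // k /step[].
by move=> k; exact: step.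
Qed.

Lemma accelerated_lyapunov u x z k : separable_sum psi u \is a fin_num ->
  (forall i, 0 < v 0 i) ->
  (forall y, separable_sum psi y \is a fin_num -> F u <= F y) ->
  fista_iterates f psi v x z \/ apg_iterates f psi v x z ->
  [/\ separable_sum psi (x k.+1) \is a fin_num,
      sqnormv v (x k.+1 - u) <= sqnormv v (x 0%N - u) &
      2 * (F (x k.+1) - F u) / theta k ^+ 2 + sqnormv v (z k.+1 - u) <=
      sqnormv v (x 0%N - u)].
Proof.
move=> ufin v0 umin xz.
have z0E : z 0%N = x 0%N by case: xz => -[].
have step := iterates_accelerated_step ufin xz.
(* [x j.+1] averages [x j] and [z j.+1]; the latter is within the initial distance because the
   objective gap is nonnegative. *)
have le_dist j : sqnormv v (x j - u) <= sqnormv v (x 0%N - u) ->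
    2 * (F (x j.+1) - F u) / theta j ^+ 2 + sqnormv v (z j.+1 - u) <=
      sqnormv v (x 0%N - u) ->
    sqnormv v (x j.+1 - u) <= sqnormv v (x 0%N - u).
  move=> xle lyap; have [xE xfin _] := step j.
  have /andP[t0 t1] := @theta_bounds R j.
  have gap0 : 0 <= 2 * (F (x j.+1) - F u) / theta j ^+ 2.
    by rewrite divr_ge0 ?exprn_ge0 ?mulr_ge0 ?subr_ge0 ?umin// ltW.
  have zle : sqnormv v (z j.+1 - u) <= sqnormv v (x 0%N - u) by lra.
  have t1' : 0 <= 1 - theta j :> R by rewrite subr_ge0.
  have := ler_wpM2l t1' xle; have := ler_wpM2l (ltW t0) zle.
  have := mulr_ge0 (mulr_ge0 (ltW t0) t1') (sqnormv_ge0 (z j.+1 - x j) v0).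
  rewrite xE sqnormv_conv; lra.
elim: k => [|k [xfin xle lyap]].
  (* Since [theta 0 = 1], the term in [F (x 0)] drops out of the first decrease. *)
  have [_ xfin] := step 0%N; rewrite /= z0E => desc.
  have lyap : 2 * (F (x 1%N) - F u) / theta 0 ^+ 2 + sqnormv v (z 1%N - u) <=
      sqnormv v (x 0%N - u) by rewrite /= expr1n divr1; lra.
  by split=> //; exact: le_dist.
have [_ xfin' desc] := step k.+1.
suff lyap' : 2 * (F (x k.+2) - F u) / theta k.+1 ^+ 2 + sqnormv v (z k.+2 - u)
    <= sqnormv v (x 0%N - u) by split=> //; exact: le_dist.
have recE := @theta_recE R k.
have /andP[t0 _] := @theta_bounds R k.
have /andP[s0 s1] := @theta_bounds R k.+1.
apply: le_trans lyap.
set t := theta k in recE t0 *; set s := theta k.+1 in recE s0 s1 desc *.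
have s2 : 0 < s ^+ 2 by rewrite exprn_gt0.
(* The recurrence gives [1 / t ^+ 2 = (1 - s) / s ^+ 2], so both sides share the denominator
   [s ^+ 2]; it also excludes [s = 1], which would force [s ^+ 2 = 0]. *)
have -> : 2 * (F (x k.+1) - F u) / t ^+ 2 =
    2 * (1 - s) * (F (x k.+1) - F u) / s ^+ 2.
  have s1' : 1 - s != 0.
    by apply: contraTneq s2 => e; rewrite recE e mul0r ltxx.
  by rewrite recE; field; rewrite s1' lt0r_neq0.
rewrite -(ler_pM2r s2) !mulrDl !divfK ?lt0r_neq0//.
lra.
Qed.

End AcceleratedStep.

(** * From the Lyapunov bound and quadratic growth to the distance bound *)

Theorem theorem1 (R : realType) (n : nat)
  (f : 'rV[R]_n -> R) (psi : 'I_n -> R -> \bar R) (v : 'rV[R]_n)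
  (mu : R) (xs : 'rV[R]_n)
  (f_convex : convex_function (E := 'rV[R]_n) setT f)
  (f_diff : forall x : 'rV[R]_n, differentiable f x)
  (psi_noninfty : forall (i : 'I_n) (t : R), psi i t <> -oo%E)
  (psi_closed : forall i : 'I_n, closed_fun (psi i))
  (psi_convex : forall i : 'I_n, econvex (psi i))
  (xs_min : argmin (composite f psi) xs)
  (v_gt0 : forall i : 'I_n, 0 < v 0 i)
  (f_smooth : forall x h : 'rV[R]_n,
     f (x + h) <= f x + dotv (grad f x) h + 2^-1 * sqnormv v h)
  (mu_gt0 : 0 < mu)
  (F_growth : forall x : 'rV[R]_n,
     (composite f psi xs + (mu / 2 * sqnormv v (x - xs))%:E
        <= composite f psi x)%E)
  (x z : nat -> 'rV[R]_n)
  (xz_iterates : fista_iterates f psi v x z \/ apg_iterates f psi v x z)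
  (sigma : R) (sigma01 : 0 <= sigma <= 1)
  (k : nat) (k_ge1 : (1 <= k)%N) :
  let xbar := (1 - sigma) *: x k + sigma *: z k in
  2^-1 * sqnormv v (xbar - xs) <=
  2^-1 * Num.max sigma (1 - sigma * mu / theta k.-1 ^+ 2)
       * sqnormv v (x 0%N - xs).
Proof.
case: k k_ge1 => [//|k _] /=.
(* An infinite value at [xs] would contradict minimality against [x 0], where the objective is
   finite. *)
have xsfin : separable_sum psi xs \is a fin_num.
  apply: separable_sum_fin_num => //.
  have : edom (separable_sum psi) (x 0%N) by case: xz_iterates => -[].
  move/(separable_sum_fin_num psi_noninfty) => x0fin.
  have := xs_min (x 0%N); rewrite /composite -(fineK x0fin) -EFinD.
  by case: (separable_sum psi xs) => [r| |] //; rewrite ltry.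
have growth y : separable_sum psi y \is a fin_num ->
    f xs + fine (separable_sum psi xs) + mu / 2 * sqnormv v (y - xs) <=
    f y + fine (separable_sum psi y).
  move=> yfin; have := F_growth y; rewrite /composite.
  by rewrite -(fineK xsfin) -(fineK yfin) -!EFinD lee_fin.
have xs_le y : separable_sum psi y \is a fin_num ->
    f xs + fine (separable_sum psi xs) <= f y + fine (separable_sum psi y).
  move=> /growth; apply: le_trans.
  by rewrite lerDl mulr_ge0 ?sqnormv_ge0// divr_ge0// ltW.
have [xfin A_le lyap] := accelerated_lyapunov f_convex f_diff psi_noninfty
  psi_convex f_smooth k xsfin v_gt0 xs_le xz_iterates.
have grow := growth _ xfin.
have /andP[t0 t1] := @theta_bounds R k.
have /andP[s0 s1] := sigma01.
rewrite -mulrA ler_pM2l ?invr_gt0// sqnormv_conv.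
have cross : 0 <= sigma * (1 - sigma) * sqnormv v (z k.+1 - x k.+1).
  by rewrite !mulr_ge0 ?sqnormv_ge0 ?subr_ge0.
have A0 := sqnormv_ge0 (x k.+1 - xs) v_gt0.
have D0 := sqnormv_ge0 (x 0%N - xs) v_gt0.
set A := sqnormv v (x k.+1 - xs) in A_le A0 grow *.
set B := sqnormv v (z k.+1 - xs) in lyap *.
set D := sqnormv v (x 0%N - xs) in A_le D0 lyap *.
set c := mu / theta k ^+ 2.
have AB : c * A + B <= D.
  apply: le_trans lyap; rewrite lerD2r /c mulrAC ler_pM2r ?invr_gt0 ?exprn_gt0//.
  lra.
have sAB := ler_wpM2l s0 AB.
rewrite -[sigma * mu / _]mulrA -/c.
(* The nonpositive case yields the entry [sigma] of the maximum, the positive case the entry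
   [1 - sigma * c]. *)
have [neg|pos] := leP (1 - sigma - sigma * c) 0.
  apply: (@le_trans _ _ (sigma * D)).
    have := mulr_le0_ge0 neg A0; lra.
  by rewrite ler_wpM2r// le_max lexx.
apply: (@le_trans _ _ ((1 - sigma * c) * D)).
  have := ler_wpM2l (ltW pos) A_le; lra.
by rewrite ler_wpM2r// le_max lexx orbT.
Qed.
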